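(* Let $0<c<1$ be fixed and let $k\geq 3$ be a fixed integer. Then there is a constant $\gamma=\gamma(c,k)>0$ such that for every even integer $n$ (sufficiently large), the number of labeled $k$-regular graphs $G$ on vertex set $\{1,\dots,n\}$ with $\mathrm{girth}(G)\geq c\log_{k-1}(n)$ is at least $(\gamma n)^{kn/2}$; that is, there are at least $(\Omega(n))^{kn/2}$ such graphs.
   Context: The girth of a graph is the length of its shortest cycle. *)

(* Defs.v *)
From HB Require Import structures.
From mathcomp Require Import all_boot all_order all_algebra.
From mathcomp Require Import all_classical all_reals all_analysis.

Set Implicit Arguments.
Unset Strict Implicit.
Unset Printing Implicit Defensive.

Import Order.TTheory GRing.Theory Num.Theory.
Local Open Scope ring_scope.

Record sgraph (T : finType) := SGraph {
  edges :> {set {set T}};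
  edges_card2 : [forall e in edges, #|e| == 2%N] }.

HB.instance Definition _ (T : finType) := [isSub for @edges T].
HB.instance Definition _ (T : finType) := [Finite of sgraph T by <:].

Definition adj (T : finType) (G : sgraph T) : rel T :=
  fun x y => [set x; y]%SET \in edges G.

Definition regular (T : finType) (k : nat) (G : sgraph T) : bool :=
  [forall x, #|[set y | adj G x y]%SET| == k].

(* The length of the cycle [s] is its number of vertices; [2 < size s] rules
   out the closed walk [:: x; y] along a single edge. *)
Definition is_cycle (T : finType) (G : sgraph T) (s : seq T) : Prop :=
  ucycle (adj G) s /\ (2 < size s)%N.

(* Valued in the extended reals, so that the girth of a forest is [+oo]. *)
Definition girth (R : realType) (T : finType) (G : sgraph T) : \bar R :=
  ereal_inf [set ((size s)%:R : R)%:E | s in [set s | is_cycle G s]]%classic.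

Definition logb (R : realType) (b x : R) : R := ln x / ln b.

Definition high_girth_graphs (R : realType) (c : R) (k n : nat) :
    {set sgraph 'I_n} :=
  [set G : sgraph 'I_n | regular k G &
     ((c * logb (k%:R - 1) n%:R)%:E <= girth R G)%E]%SET.

(* Main.v *)
Require Import Defs.
From HB Require Import structures.
From mathcomp Require Import all_boot all_order all_algebra.
From mathcomp Require Import all_classical all_reals all_analysis.
From mathcomp Require Import zify ring lra.
Import fintype mathcomp.boot.finset.

Set Implicit Arguments.
Unset Strict Implicit.
Unset Printing Implicit Defensive.

Import Order.TTheory GRing.Theory Num.Theory.

(** Let [A_m] be the set of graphs with [m] edges, maximum degree at most [k]
   and no cycle of length at most [r + 1], where [r] is about [c log_(k-1) n],
   so that balls of radius [r] have [O(n^c)] vertices.  Put [N = k n / 2].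

   Far from saturation, two random unsaturated vertices are usually at distance
   more than [r] and may be joined; double counting gives
   [|A_m| (N - m)^2 <= k^2 (m + 1) |A_(m+1)|] as long as [N - m >= J], for some
   [J = O(n^c)].  For the last [J] edges we use the switch of Erdos and Sachs:
   pick unsaturated [u], [v] (possibly equal) and an edge [x y] far from both,
   and replace [x y] by [u x] and [v y].  A switch is determined by its result
   and [(u, v, x, y)], so [|A_m| <= n^4 |A_(m+1)|].

   Altogether [N! <= (J!)^2 k^(2N) n^(4J) |A_N|], and since [J log n = o(n)]
   the factors involving [J] are at most exponential in [n]. *)

(** * Balls and walks in a graph given by its edge set *)

Section EdgeSets.
Variable T : finType.
Implicit Types (E F : {set {set T}}) (e : {set T}) (x y z u v w : T).

Definition eadj E : rel T := fun x y => [set x; y] \in E.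

Lemma eadjC E x y : eadj E x y = eadj E y x.
Proof. by rewrite /eadj setUC. Qed.

Lemma set2_eq (x y u v : T) : [set x; y] = [set u; v] ->
  (x = u /\ y = v) \/ (x = v /\ y = u).
Proof.
move=> h.
have := set21 x y; have := set22 x y; rewrite h !inE.
have := set21 u v; have := set22 u v; rewrite -h !inE.
by do 4 case/orP=> /eqP ?; subst; auto.
Qed.

Fixpoint ball E x d : {set T} :=
  if d is d'.+1 then
    ball E x d' :|: [set z | [exists w in ball E x d', eadj E w z]]
  else [set x].

Lemma ballP E x d z : reflect
  (z \in ball E x d \/ exists2 w, w \in ball E x d & eadj E w z)
  (z \in ball E x d.+1).
Proof.
rewrite /= in_setU inE; apply: (iffP orP) => -[]; try by left.
- by case/existsP=> w /andP[]; right; exists w.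
- by case=> w h1 h2; right; apply/existsP; exists w; rewrite h1.
Qed.

Lemma ball_center E x d : x \in ball E x d.
Proof. by elim: d => [|d IH]; [rewrite inE | apply/ballP; left]. Qed.

Lemma ball_cons E x y d z :
  eadj E x y -> z \in ball E y d -> z \in ball E x d.+1.
Proof.
move=> xy; elim: d z => [|d IH] z.
  by rewrite inE => /eqP->; apply/ballP; right; exists x; rewrite ?ball_center.
case/ballP=> [/IH zb|[w /IH wb wz]]; apply/ballP; first by left.
by right; exists w.
Qed.

Lemma ball_sym E x d z : z \in ball E x d -> x \in ball E z d.
Proof.
elim: d z => [|d IH] z; first by rewrite !inE eq_sym.
case/ballP=> [/IH zb|[w /IH wb wz]]; first by apply/ballP; left.
by apply: ball_cons wb; rewrite eadjC.
Qed.

Lemma ball_mono E F x d : E \subset F -> ball E x d \subset ball F x d.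
Proof.
move=> EF; elim: d => // d /subsetP IH; apply/subsetP=> z.
case/ballP=> [/IH zb|[w /IH wb wz]]; apply/ballP; first by left.
by right; exists w => //; apply: (subsetP EF).
Qed.

Lemma path_ball E x p d :
  path (eadj E) x p -> size p <= d -> last x p \in ball E x d.
Proof.
elim: p x d => [|y p IH] x [|d] //=; rewrite ?inE ?eqxx //.
  by move=> _ _; rewrite ball_center.
by case/andP=> xy yp sp; have := ball_cons xy (IH _ _ yp sp); rewrite !inE.
Qed.

Lemma ball_path E x d z : z \in ball E x d ->
  exists p, [/\ path (eadj E) x p, last x p = z & size p <= d].
Proof.
elim: d z => [|d IH] z; first by rewrite inE => /eqP->; exists [::].
case/ballP=> [/IH[p [pp lp sp]]|[w /IH[p [pp lp sp]] wz]].
  by exists p; split=> //; lia.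
by exists (rcons p z); rewrite rcons_path last_rcons size_rcons pp lp.
Qed.

(* Adding the edge [u v] can only create walks through [u] or [v]; cutting
   a walk at its last use of the new edge leaves a walk without it. *)
Lemma ball_addedge E u v x d z : z \in ball ([set u; v] |: E) x d ->
  [\/ z \in ball E x d, u \in ball E x d | v \in ball E x d].
Proof.
elim: d z => [|d IH] z; first by rewrite !inE => ->; constructor 1.
have up w : w \in ball E x d -> w \in ball E x d.+1.
  by move=> wb; apply/ballP; left.
case/ballP=> [/IH[]/up|[w /IH[] wb wz]];
  try by [constructor 1 | constructor 2 | constructor 3
         | constructor 2; apply: up | constructor 3; apply: up].
case/setU1P: wz => [/set2_eq[][? ?]|wz]; subst.
- by constructor 2; apply: up.
- by constructor 3; apply: up.
- by constructor 1; apply/ballP; right; exists w.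
Qed.

(** * Degrees and the growth of balls *)

Definition deg E x := #|[set y | eadj E x y]|.

Lemma card_bigcup_le (I : finType) (A : {set I}) (F : I -> {set T}) c :
  (forall i, i \in A -> #|F i| <= c) -> #|\bigcup_(i in A) F i| <= #|A| * c.
Proof.
move=> Fc; apply: (@leq_trans (\sum_(i in A) #|F i|)).
  elim/big_ind2: _ => [|m X m' Y h1 h2|//]; first by rewrite cards0.
  by apply: leq_trans (leq_add h1 h2); rewrite leq_card_setU.
by rewrite -sum_nat_const; apply: leq_sum.
Qed.

(** A vertex first reached at step [d + 1] has a neighbour in the ball of radius [d], hence at most
    [k - 1] neighbours outside that ball. *)
Lemma card_sphere E k x d : (forall y, deg E y <= k) ->
  #|ball E x d.+1 :\: ball E x d| <= k * k.-1 ^ d.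
Proof.
move=> degk; elim: d => [|d IH].
  rewrite expn0 muln1; apply: leq_trans (degk x); apply: subset_leq_card.
  apply/subsetP=> z /setDP[/ballP[->//|[w]]].
  by rewrite !inE => /eqP->.
have sub : ball E x d.+2 :\: ball E x d.+1 \subset
    \bigcup_(w in ball E x d.+1 :\: ball E x d)
      ([set y | eadj E w y] :\: ball E x d).
  apply/subsetP=> z /setDP[/ballP[-> //|[w wb wz]] zb].
  apply/bigcupP; exists w.
    rewrite in_setD wb andbT; apply: contra zb => wb'.
    by apply/ballP; right; exists w.
  rewrite in_setD inE wz andbT; apply: contra zb => zb.
  by apply/ballP; left.
apply: leq_trans (subset_leq_card sub) _.
rewrite expnSr mulnA.
apply: leq_trans (leq_mul IH (leqnn k.-1)).
apply: card_bigcup_le => w /setDP[/ballP[-> //|[y yb yw]] wb].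
have wy : y \in [set y | eadj E w y] by rewrite inE eadjC.
have := degk w; rewrite /deg (cardsD1 y) wy add1n => h.
apply: (@leq_trans #|[set y | eadj E w y] :\ y|); last by lia.
by apply/subset_leq_card/setDS; rewrite sub1set.
Qed.

(** Since [k - 1 >= 2], the old ball and the new sphere, each at most [k (k-1)^d], fit together
    under [k (k-1)^(d+1)]. *)
Lemma card_ball E k x d : 2 < k -> (forall y, deg E y <= k) ->
  #|ball E x d| <= k * k.-1 ^ d.
Proof.
move=> k2 degk; elim: d => [|d IH]; first by rewrite cards1; lia.
rewrite -(cardsID (ball E x d)) expnS.
have -> : ball E x d.+1 :&: ball E x d = ball E x d.
  by apply/setIidPr/subsetP=> z zb; apply/ballP; left.
have := card_sphere x d degk; move: IH; set t := _ ^ d.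
have -> : k * (k.-1 * t) = k.-1 * (k * t) by lia.
have : 2 * (k * t) <= k.-1 * (k * t) by rewrite leq_mul2r; lia.
lia.
Qed.

Definition simple E := [forall e in E, #|e| == 2].

Lemma degE E x : simple E -> deg E x = \sum_(e in E) (x \in e).
Proof.
move=> /forall_inP sE.
rewrite -big_mkcondr sum1dep_card /deg.
have sE' : forall y, eadj E x y -> x != y.
  by move=> y /sE; rewrite cards2; case: (x != y).
rewrite -(@card_in_imset _ _ (fun y => [set x; y])); last first.
  move=> y z; rewrite !inE => /sE' xy /sE' xz /set2_eq[][] //.
  by move=> xz'; rewrite xz' eqxx in xz.
apply: eq_card => e; rewrite inE; apply/imsetP/andP.
  by case=> y; rewrite inE => xy ->; rewrite set21.
case=> eE xe; have /cards2P[a [b [ab ee]]] := sE _ eE.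
move: xe eE; rewrite {}ee => /set2P[] <- eE.
  by exists b; rewrite // inE.
by exists a; rewrite 1?setUC // inE /eadj setUC.
Qed.

Lemma handshake E : simple E -> \sum_x deg E x = 2 * #|E|.
Proof.
move=> sE; under eq_bigr do rewrite degE //.
rewrite exchange_big /= mulnC -sum_nat_const; apply: eq_bigr => e eE.
by rewrite -big_mkcond /= sum1_card; apply/eqP; move/forall_inP: sE; apply.
Qed.

Lemma simple_add E e : simple E -> #|e| = 2 -> simple (e |: E).
Proof.
move=> /forall_inP sE e2; apply/forall_inP => f /setU1P[->|/sE//].
by rewrite e2.
Qed.

Lemma simple_sub E F : E \subset F -> simple F -> simple E.
Proof.
by move=> /subsetP EF /forall_inP sF; apply/forall_inP => f /EF /sF.
Qed.

Lemma deg_add E e x : simple E -> #|e| = 2 -> e \notin E ->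
  deg (e |: E) x = (x \in e) + deg E x.
Proof.
by move=> sE e2 eE; rewrite !degE ?simple_add // big_setU1.
Qed.

Lemma deg_del E e x : simple E -> e \in E ->
  deg E x = (x \in e) + deg (E :\ e) x.
Proof.
move=> sE eE; rewrite !degE ?(simple_sub _ sE) ?subD1set //.
by rewrite (big_setD1 e).
Qed.

(** * Cycle lengths when edges are added, deleted or switched *)

Definition long_cycles r E :=
  forall s, ucycle (eadj E) s -> 2 < size s -> r.+1 < size s.

Lemma sub_long_cycles r E F : E \subset F -> long_cycles r F -> long_cycles r E.
Proof.
move=> /subsetP EF lF s /andP[cs us] s2; apply: lF => //; apply/andP; split=> //.
by apply: sub_cycle cs => x y; apply: EF.
Qed.

Lemma path_avoid E a b z q : b \notin z :: q ->
  path (eadj ([set a; b] |: E)) z q -> path (eadj E) z q.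
Proof.
elim: q z => //= y q IH z; rewrite inE negb_or => /andP[bz bq].
case/andP=> zy yq; rewrite IH // andbT; case/setU1P: zy => // /set2_eq[][? ?];
subst.
  by rewrite inE eqxx in bq.
by rewrite eqxx in bz.
Qed.

(** A new cycle uses the edge [u v], and the rest of it joins [u] to [v] in [E]. That takes more
    than [r] edges, so the cycle has length at least [r + 2]. *)
Lemma long_cycles_add r E u v : long_cycles r E ->
  v \notin ball E u r -> long_cycles r ([set u; v] |: E).
Proof.
move=> lE vu s /andP[cs us] s2; case: (boolP (cycle (eadj E) s)) => [csE|ncs].
  by apply: lE => //; apply/andP.
have [x xs nx] : exists2 x, x \in s & ~~ eadj E x (next s x).
  apply/hasP; rewrite has_predC; apply: contra ncs => /allP h.
  exact: cycle_from_next.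
(* Rotate the cycle so that it starts with the new edge, from [x] to its successor [y]. *)
have [i p sp] := rot_to xs.
have xe := next_cycle cs xs; move: nx xe.
rewrite -(next_rot i us) sp -(size_rot i s) sp.
move: us; rewrite -(rot_uniq i) sp; move: cs; rewrite -(rot_cycle i) sp.
move: s2; rewrite -(size_rot i s) sp.
case: p {sp} => [|y [|z q]] //= _.
rewrite eqxx => /and3P[xy yz zq] us nxy _.
rewrite ltnNge; apply/negP => sq.
have exy : [set x; y] = [set u; v].
  by case/setU1P: xy => // xyE; rewrite /eadj xyE in nxy.
have xb : x \in ball E y r.
  (* The remaining walk [y, z, ..., x] lies in [E]: its first step does not reach [x] because
     [z != x], and the later ones avoid [y]. *)
  have -> : x = last y (z :: rcons q x) by rewrite /= last_rcons.
  apply: path_ball; last by rewrite /= size_rcons; lia.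
  rewrite /=; apply/andP; split.
    case/setU1P: yz => // /esym; rewrite -exy => /set2_eq[][? ?]; subst.
      by rewrite /= inE eqxx in us.
    by rewrite !inE eqxx orbT in us.
  apply: (@path_avoid _ x y); last by rewrite exy.
  rewrite inE mem_rcons inE; move: us; rewrite /= !inE.
  move=> /and3P[]; rewrite !negb_or => /and3P[xy' _ _] /andP[-> ->] _.
  by rewrite eq_sym xy'.
case/negP: vu; case: (set2_eq exy) => -[? ?]; subst => //.
exact: ball_sym.
Qed.

(** A path of at most [r] edges from [x] to [y] avoiding the edge [x y] would close up with that
    edge to a cycle of length at most [r + 1]. *)
Lemma long_cycles_del r E x y : simple E -> long_cycles r E ->
  [set x; y] \in E -> x \notin ball (E :\ [set x; y]) y r.
Proof.
move=> /forall_inP sE lE xyE; apply/negP => /ball_sym/ball_path[p [pp lp sp]].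
have xy : x != y by have := sE _ xyE; rewrite cards2; case: (x != y).
case: (shortenP pp) lp => p' pp' up' sub lp.
have sp' : size p' <= r.
  apply: leq_trans sp; apply: uniq_leq_size; last exact: sub.
  by case/andP: up'.
have := lE (x :: p').
rewrite /ucycle up' andbT => h.
have : r.+1 < size (x :: p').
  apply: h.
    rewrite /= rcons_path lp eadjC {2}/eadj xyE andbT.
    by apply: sub_path pp' => a b /setD1P[].
  (* The shortened path has at least two edges, because [x != y] and the edge [x y] has been
     deleted. *)
  case: p' pp' lp {up' sub sp'} => [|a [|b p']] //=.
    by move=> _ xy'; rewrite xy' eqxx in xy.
  by rewrite andbT => xa ay; rewrite ay /eadj !inE eqxx in xa.
by rewrite /= ltnS ltnNge sp'.
Qed.

(** Adding [u x] is safe by distance in [E]. For [v y], [ball_addedge] turns a short walk from [y]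
    to [v] into one in [E] minus [x y] that ends at [v], [u] or [x]; the first two are too far, and
    the last is excluded by [long_cycles_del]. *)
Lemma long_cycles_switch r E u v x y : simple E -> long_cycles r E ->
  [set x; y] \in E ->
  x \notin ball E u r -> y \notin ball E u r -> y \notin ball E v r ->
  long_cycles r ([set v; y] |: ([set u; x] |: E :\ [set x; y])).
Proof.
move=> sE lE xyE xu yu yv.
have sub : E :\ [set x; y] \subset E by rewrite subD1set.
have far a b : b \notin ball E a r -> b \notin ball (E :\ [set x; y]) a r.
  by apply: contra; apply/subsetP/ball_mono.
apply: long_cycles_add.
  by apply: long_cycles_add (far _ _ xu); apply: sub_long_cycles lE.
apply/negP => /ball_sym /ball_addedge[]; last exact/negP/long_cycles_del.
  by move/ball_sym; apply/negP/far.
by move/ball_sym; apply/negP/far.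
Qed.

End EdgeSets.

(** * Double counting of labelled moves *)

Lemma card_dep_pairs (X C : finType) (A : {set X}) (F : X -> {set C}) :
  #|[set p : X * C | (p.1 \in A) && (p.2 \in F p.1)]| = \sum_(a in A) #|F a|.
Proof.
rewrite -sum1dep_card; under [RHS]eq_bigr do rewrite -sum1_card.
by rewrite pair_big_dep.
Qed.

(** The label [c] records a move from [a] to [f a c]. The result and the label together determine
    [a], so moves inject into pairs of some [b] and a label in [H b]. *)
Lemma double_count (X Y C : finType) (A : {set X}) (B : {set Y})
    (F : X -> {set C}) (H : Y -> {set C}) (f : X -> C -> Y) q :
  (forall a c, a \in A -> c \in F a -> f a c \in B /\ c \in H (f a c)) ->
  (forall a a' c, a \in A -> a' \in A -> c \in F a -> c \in F a' ->
     f a c = f a' c -> a = a') ->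
  (forall b, b \in B -> #|H b| <= q) ->
  \sum_(a in A) #|F a| <= #|B| * q.
Proof.
move=> fB fI Hq; rewrite -sum_nat_const.
apply: leq_trans (leq_sum _ Hq).
rewrite -!card_dep_pairs.
rewrite -(@card_in_imset _ _ (fun p => (f p.1 p.2, p.2))); last first.
  move=> [a c] [a' c']; rewrite !inE /= => /andP[aA cF] /andP[aA' cF'] [e ec].
  by subst c'; rewrite (fI _ _ _ aA aA' cF cF' e).
apply/subset_leq_card/subsetP => _ /imsetP[[a c] + ->].
by rewrite !inE /= => /andP[aA cF]; apply/andP/fB.
Qed.

(** * The families of partial graphs and the moves between them *)

Section Families.
Variable T : finType.
Implicit Types (E F : {set {set T}}) (e : {set T}) (x y z u v w : T).

(** The set [A_m] of the overview, kept as bare edge sets so that edges can be added and deleted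
    without rebuilding an [sgraph]. *)
Definition family k r m : {set {set {set T}}} :=
  [set E | [&& simple E, [forall x, deg E x <= k], `[< long_cycles r E >]
             & #|E| == m]].

Lemma familyP k r m E : reflect
  [/\ simple E, forall x, deg E x <= k, long_cycles r E & #|E| = m]
  (E \in family k r m).
Proof.
rewrite inE; apply: (iffP and4P) => -[sE dE lE cE]; split=> //.
- exact/forallP.
- exact/asboolP.
- exact/eqP.
- exact/forallP.
- exact/asboolP.
- exact/eqP.
Qed.

Lemma family0 k r : set0 \in family k r 0.
Proof.
apply/familyP; split; rewrite ?cards0 //.
- by apply/forall_inP => e; rewrite inE.
- by move=> x; rewrite /deg eq_card0 // => y; rewrite /eadj !inE.
- case=> [|x [|y s]] //.
  by case/andP=> /=; rewrite {1}/eadj inE.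
Qed.

Lemma sum_deficit k r m N E : k * #|T| = 2 * N -> E \in family k r m ->
  \sum_x (k - deg E x) = 2 * (N - m).
Proof.
move=> kN /familyP[sE dE _ cE].
have : \sum_x (k - deg E x) + \sum_x deg E x = 2 * N.
  rewrite -big_split /= -kN mulnC -sum_nat_const.
  by apply: eq_bigr => x _; rewrite subnK.
by rewrite handshake // cE; lia.
Qed.

Lemma card_unsaturated k r m N E : k * #|T| = 2 * N -> E \in family k r m ->
  2 * (N - m) <= k * #|[set x | deg E x < k]|.
Proof.
move=> kN EF; rewrite -(sum_deficit kN EF) mulnC -sum_nat_const.
rewrite [leqRHS]big_mkcond; apply: leq_sum => x _.
by rewrite inE; case: ltnP; lia.
Qed.

Lemma family_add k r m N : 2 < k -> 0 < r -> k * #|T| = 2 * N ->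
  k * (k * k.-1 ^ r) <= N - m ->
  #|family k r m| * (N - m) ^ 2 <= k ^ 2 * m.+1 * #|family k r m.+1|.
Proof.
move=> k2 r0 kN; set b := k * k.-1 ^ r => bm.
pose F E := [set p : T * T | (p.1 \in [set x | deg E x < k]) &&
   (p.2 \in [set x | deg E x < k] :\: ball E p.1 r)].
pose H E := [set p : T * T | eadj E p.1 p.2].
(* As [r > 0], a vertex outside the ball around [p.1] is neither [p.1] nor adjacent to it. *)
have notE E (p : T * T) : p \in F E -> p.1 != p.2 /\ [set p.1; p.2] \notin E.
  rewrite !inE => /and3P[_ pb _]; split.
    by apply: contraNN pb => /eqP<-; rewrite ball_center.
  apply: contraNN pb => pE; apply: (@path_ball _ E p.1 [:: p.2] r) => //=.
  by rewrite andbT.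
(* The added edge is one of the [m + 1] edges of the result, in one of two orientations. *)
have : \sum_(E in family k r m) #|F E| <= #|family k r m.+1| * (2 * m.+1).
  apply: (@double_count _ _ _ _ _ F H (fun E p => [set p.1; p.2] |: E)).
  - move=> E p /familyP[sE dE lE cE] pF.
    have [p12 pE] := notE _ _ pF.
    have e2 : #|[set p.1; p.2]| = 2 by rewrite cards2 p12.
    split; last by rewrite inE /eadj setU11.
    move: pF; rewrite [_ \in F E]inE in_setD !(in_set (fun x => deg E x < k)).
    case/and3P=> [p1k pb p2k].
    apply/familyP; split.
    + exact: simple_add.
    + move=> x; rewrite deg_add // !inE.
      by have := dE x; case: eqP => [->|_]; case: eqP => [->|_] /=; lia.
    + exact: long_cycles_add.
    + by rewrite cardsU1 pE cE.
  - move=> E E' p _ _ /notE[_ pE] /notE[_ pE'] eE.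
    by rewrite -(setU1K pE) eE setU1K.
  - move=> E /familyP[sE _ _ cE].
    have -> : #|H E| = \sum_x deg E x; last by rewrite handshake // cE.
    rewrite (eq_bigl (fun x => x \in [set: T])) => [|x]; last by rewrite inE.
    by rewrite -card_dep_pairs; apply: eq_card => p; rewrite !inE.
(* With [t] unsaturated vertices, [k t >= 2 (N - m)] gives [t >= 2 b]. Hence at least
   [t (t - b) >= t^2 / 2] ordered pairs are far apart. *)
have Flow E : E \in family k r m -> 2 * (N - m) ^ 2 <= k ^ 2 * #|F E|.
  move=> EF; have := card_unsaturated kN EF.
  case/familyP: EF => sE dE lE cE.
  set U := [set x | deg E x < k] => hU.
  rewrite (card_dep_pairs U (fun u => U :\: ball E u r)).
  have : #|U| * (#|U| - b) <= \sum_(a in U) #|U :\: ball E a r|.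
    rewrite -sum_nat_const; apply: leq_sum => u _.
    rewrite cardsD leq_sub2l //; apply: leq_trans (card_ball u r k2 dE).
    by rewrite subset_leq_card // subsetIr.
  move: (\sum_(a in U) _) => S hS.
  have : 2 * b <= #|U| by rewrite -(leq_pmul2l (_ : 0 < k)); lia.
  move: #|U| hU hS => t hU hS ht.
  apply: (@leq_trans (k ^ 2 * (t * (t - b)))); last
    by rewrite leq_mul2l hS orbT.
  have h2 : t * t <= 2 * (t * (t - b)).
    by rewrite mulnCA leq_mul2l; apply/orP; right; lia.
  have h3 : (2 * (N - m)) * (2 * (N - m)) <= (k * t) * (k * t) by apply: leq_mul.
  have h4 : k ^ 2 * (t * t) <= k ^ 2 * (2 * (t * (t - b))).
    by rewrite leq_mul2l h2 orbT.
  move: (t * (t - b)) h4 => q; move: h3; rewrite -!mulnn; nia.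
move=> hF; rewrite -(leq_pmul2l (_ : 0 < 2)) //.
have : \sum_(E in family k r m) 2 * (N - m) ^ 2 <=
       \sum_(E in family k r m) k ^ 2 * #|F E| by apply: leq_sum => E /Flow.
rewrite sum_nat_const -big_distrr /= => h.
have -> : 2 * (#|family k r m| * (N - m) ^ 2) =
  #|family k r m| * (2 * (N - m) ^ 2) by lia.
apply: leq_trans h _.
have -> : 2 * (k ^ 2 * m.+1 * #|family k r m.+1|) =
  k ^ 2 * (#|family k r m.+1| * (2 * m.+1)) by lia.
by rewrite leq_mul2l hF orbT.
Qed.

(** The total deficit is at least 2: either one vertex misses two edges, and [u = v], or two
    distinct vertices miss one each. Adding both indicators to the degree covers the two cases at
    once. *)
Lemma family_deficit_pair k r m N E : k * #|T| = 2 * N -> m < N ->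
  E \in family k r m ->
  exists u v, forall z, deg E z + (z == u) + (z == v) <= k.
Proof.
move=> kN mN EF; have sumD := sum_deficit kN EF.
case/familyP: EF => _ dE _ _.
have [u uk] : exists u, deg E u < k.
  apply/existsP; apply: contraLR mN; rewrite negb_exists => /forallP h.
  move: sumD; rewrite big1 => [|x _]; first by lia.
  by have := h x; lia.
case: (ltnP (deg E u).+1 k) => [uk2|ku].
  by exists u, u => z; have := dE z; case: eqP => [->|_]; lia.
have [v vu vk] : exists2 v, v != u & deg E v < k.
  apply/exists_inP; apply: contraLR mN; rewrite negb_exists_in => /forall_inP h.
  move: sumD; rewrite (bigD1 u) //= big1 => [|x xu]; first by lia.
  by have := h x xu; lia.
exists u, v => z; have := dE z; case: (eqVneq z u) => [->|_].
  by rewrite eq_sym (negPf vu); lia.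
by case: eqP => [->|_]; lia.
Qed.

Lemma card_incident E w : simple E -> #|[set e in E | w \in e]| = deg E w.
Proof. by move=> sE; rewrite degE // -big_mkcondr sum1dep_card. Qed.

(** At most [k] edges meet each vertex of [W], so too few edges meet [W] to exhaust [E]. *)
Lemma far_edge E (W : {set T}) k : simple E -> (forall x, deg E x <= k) ->
  #|W| * k < #|E| ->
  exists x y, [/\ [set x; y] \in E, x \notin W & y \notin W].
Proof.
move=> sE dE WE.
have : ~~ (E \subset \bigcup_(w in W) [set e in E | w \in e]).
  apply/negP => /subset_leq_card; apply/negP; rewrite -ltnNge.
  apply: leq_ltn_trans WE; apply: card_bigcup_le => w _.
  by rewrite card_incident.
case/subsetPn=> e eE eW; have /forall_inP/(_ _ eE) := sE.
case/cards2P=> x [y [_ ee]]; exists x, y; subst e; split=> //.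
  apply: contra eW => xW; apply/bigcupP; exists x => //.
  by rewrite in_set eE set21.
apply: contra eW => yW; apply/bigcupP; exists y => //.
by rewrite in_set eE set22.
Qed.

(** Every member admits at least one switch, since two balls cannot meet more than
    [2 k (k (k-1)^r) < m] edges. A label is a quadruple of vertices, which gives the factor
    [#|T| ^ 4]. *)
Lemma family_switch k r m N : 2 < k -> 0 < r -> k * #|T| = 2 * N -> m < N ->
  2 * (k * (k * k.-1 ^ r)) < m ->
  #|family k r m| <= #|family k r m.+1| * #|T| ^ 4.
Proof.
move=> k2 r0 kN mN bm.
pose F E := [set c : (T * T) * (T * T) |
   [&& [forall z, deg E z + (z == c.1.1) + (z == c.1.2) <= k],
       [set c.2.1; c.2.2] \in E,
       c.2.1 \notin ball E c.1.1 r :|: ball E c.1.2 r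
     & c.2.2 \notin ball E c.1.1 r :|: ball E c.1.2 r]].
pose f E (c : (T * T) * (T * T)) :=
  [set c.1.2; c.2.2] |: ([set c.1.1; c.2.1] |: E :\ [set c.2.1; c.2.2]).
have far E a b : b \notin ball E a r -> a != b /\ [set a; b] \notin E.
  move=> ab; split; first by apply: contraNN ab => /eqP<-; rewrite ball_center.
  apply: contraNN ab => abE; apply: (@path_ball _ E a [:: b] r) => //=.
  by rewrite andbT.
(* The deleted edge is present and the two inserted ones are new and distinct; this gives the exact
   edge count and lets a switch be undone. *)
have FP E c : simple E -> c \in F E ->
    [/\ [set c.2.1; c.2.2] \in E,
        [set c.1.1; c.2.1] \notin E :\ [set c.2.1; c.2.2]
      & [set c.1.2; c.2.2] \notin [set c.1.1; c.2.1] |: E :\ [set c.2.1; c.2.2]].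
  move=> /forall_inP sE.
  rewrite inE => /and4P[_ cE xc yc]; rewrite !in_setU !negb_or in xc yc.
  case/andP: xc yc => /far[_ c1] /far[n12 _] /andP[_ /far[_ c2]]; split=> //.
    by rewrite in_setD1 (negPf c1) andbF.
  rewrite in_setU1 in_setD1 (negPf c2) andbF orbF.
  apply/eqP => /set2_eq[][e1 e2]; last by rewrite e1 eqxx in n12.
  by have := sE _ cE; rewrite e2 setUid cards1.
rewrite -sum1_card.
apply: (@leq_trans (\sum_(E in family k r m) #|F E|)).
  apply: leq_sum => E EF; have [u [v uvk]] := family_deficit_pair kN mN EF.
  case/familyP: EF => sE dE lE cE.
  have [x [y [xyE xW yW]]] : exists x y, [/\ [set x; y] \in E,
      x \notin ball E u r :|: ball E v r & y \notin ball E u r :|: ball E v r].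
    apply: (far_edge sE dE); rewrite cE; apply: leq_ltn_trans bm.
    have := card_ball u r k2 dE; have := card_ball v r k2 dE.
    have [+ _] := leq_card_setU (ball E u r) (ball E v r).
    move: (k * _ ^ _) => b *.
    by rewrite mulnCA mulnC leq_mul2l; lia.
  apply/card_gt0P; exists ((u, v), (x, y)).
  by rewrite inE xyE xW yW !andbT; apply/forallP.
have -> : #|T| ^ 4 = #|[set: (T * T) * (T * T)]|.
  by rewrite cardsT !card_prod; lia.
apply: (@double_count _ _ _ _ _ F (fun _ => setT) f) => //.
- move=> E c /familyP[sE dE lE cE] cF; split; last by rewrite in_setT.
  have [c0 c1 c2] := FP _ _ sE cF.
  have s1 : simple (E :\ [set c.2.1; c.2.2]).
    by apply: simple_sub sE; rewrite subD1set.
  rewrite inE in cF; case/and4P: cF => /forallP degc _ xc yc.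
  rewrite !in_setU !negb_or in xc yc.
  case/andP: xc yc => xu xv /andP[yu yv].
  have e1 : #|[set c.1.1; c.2.1]| = 2 by rewrite cards2 (far _ _ _ xu).1.
  have e2 : #|[set c.1.2; c.2.2]| = 2 by rewrite cards2 (far _ _ _ yv).1.
  have s2 := simple_add s1 e1.
  apply/familyP; split.
  + exact: simple_add.
  (* Losing [x y] compensates [x] and [y] for their new edges, so only the degrees at [u] and [v]
     can grow. *)
  + move=> z; rewrite /f deg_add // deg_add //.
    apply: leq_trans (degc z); rewrite (deg_del z sE c0) !in_set2.
    have xy : c.2.1 != c.2.2.
      by have /forall_inP/(_ _ c0) := sE; rewrite cards2; case: (_ != _).
    move: (deg (E :\ _) z) => d.
    case: (eqVneq z c.2.1) => [->|_].
      by rewrite (negPf xy); do 2![case: (_ == _)]; rewrite /=; clear; lia.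
    by do 3![case: (_ == _)]; rewrite /=; clear; lia.
  + exact: long_cycles_switch.
  + by rewrite /f !cardsU1 c1 c2 !add1n -cE (cardsD1 [set c.2.1; c.2.2] E) c0.
- move=> E E' c /familyP[sE _ _ _] /familyP[sE' _ _ _].
  move=> /(FP _ _ sE)[c0 c1 c2] /(FP _ _ sE')[c0' c1' c2'] eE.
  have : E :\ [set c.2.1; c.2.2] = E' :\ [set c.2.1; c.2.2].
    by rewrite -(setU1K c1) -(setU1K c2) -/(f E c) eE /f !setU1K.
  by move=> h; rewrite -(setD1K c0) h setD1K.
Qed.

(** Iterate [family_add] from the empty graph: the factors [(N - m)^2] telescope to a squared
    quotient of factorials, and the factors [m + 1] multiply to [i!]. *)
Lemma family_greedy k r N i : 2 < k -> 0 < r -> k * #|T| = 2 * N ->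
  i <= N - k * (k * k.-1 ^ r) ->
  N`! ^ 2 <= (N - i)`! ^ 2 * k ^ (2 * i) * i`! * #|family k r i|.
Proof.
move=> k2 r0 kN; elim: i => [|i IH] iN.
  rewrite subn0 muln0 expn0 fact0 !muln1 leq_pmulr //.
  by apply/card_gt0P; exists set0; apply: family0.
apply: leq_trans (IH (ltnW iN)) _.
have b0 : 0 < k * (k * k.-1 ^ r) by rewrite !muln_gt0 expn_gt0; lia.
have h : #|family k r i| * (N - i) ^ 2 <= k ^ 2 * i.+1 * #|family k r i.+1|.
  by apply: family_add => //; move: (k * (k * _)) b0 iN => b; clear; lia.
have Ni : N - i = (N - i.+1).+1 by move: b0 iN; move: (k * (k * _)); clear; lia.
rewrite Ni factS -Ni mulnS expnD factS expnMn.
have := leq_mul h (leqnn ((N - i.+1)`! ^ 2 * k ^ (2 * i) * i`!)).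
move: (_ ^ 2) (_ ^ 2) (_ ^ 2) (k ^ _) (i`!) #|_| #|_| => a1 a2 a3 a4 a5 a6 a7.
move=> h'; apply: leq_trans (leq_trans h' _).
  by apply: eq_leq; clear; lia.
by apply: eq_leq; clear; nia.
Qed.

(** The condition that [N] exceeds three times the threshold keeps the edge count above twice the
    threshold throughout these last steps, as [family_switch] demands. *)
Lemma family_complete k r N j : 2 < k -> 0 < r -> k * #|T| = 2 * N ->
  3 * (k * (k * k.-1 ^ r)) < N -> j <= k * (k * k.-1 ^ r) ->
  #|family k r (N - j)| <= #|family k r N| * #|T| ^ (4 * j).
Proof.
move=> k2 r0 kN bN; elim: j => [|j IH] jb.
  by rewrite subn0 muln0 expn0 muln1.
have bound : N - j.+1 < N /\ 2 * (k * (k * k.-1 ^ r)) < N - j.+1.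
  by move: jb bN; move: (k * (k * _)); clear; lia.
apply: leq_trans (@family_switch k r (N - j.+1) N _ _ _ _ _) _ => //;
  try by case: bound.
have -> : (N - j.+1).+1 = N - j by case: bound; clear; lia.
by rewrite mulnS addnC expnD mulnA leq_mul2r IH ?orbT // ltnW.
Qed.

Lemma fact_le_family k r N : 2 < k -> 0 < r -> k * #|T| = 2 * N ->
  let b := k * (k * k.-1 ^ r) in 3 * b < N ->
  N`! <= b`! ^ 2 * k ^ (2 * N) * #|T| ^ (4 * b) * #|family k r N|.
Proof.
move=> k2 r0 kN b bN.
have bN' : b <= N by move: bN; clear; lia.
(* Multiply by a second [N!] to match [family_greedy] at [i = N - b]; it is cancelled against the
   factor [(N - b)!]. *)
rewrite -(leq_pmul2r (fact_gt0 N)) mulnn.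
apply: leq_trans (family_greedy k2 r0 kN (leqnn _)) _.
rewrite -/b subKn //.
have h1 : (N - b)`! <= N`!.
  by rewrite leq_fact ?leq_subr.
have h2 : k ^ (2 * (N - b)) <= k ^ (2 * N).
  by rewrite leq_exp2l ?leq_mul2l ?leq_subr //; lia.
have h3 := family_complete k2 r0 kN bN (leqnn _); rewrite -/b in h3.
apply: leq_trans (leq_mul (leq_mul (leq_mul (leqnn _) h2) h1) h3) _.
apply: eq_leq; rewrite -!mulnA; congr (_ * (_ * _)).
by congr (_ * _); rewrite [LHS]mulnC -mulnA mulnCA.
Qed.

End Families.

(** * Passage to graphs of high girth, and asymptotic estimates *)

Local Open Scope ring_scope.

(** With [N = k n / 2] edges the total deficit is zero, so every vertex has degree exactly [k]. *)
Lemma card_family_le_high_girth (R : realType) (c : R) (k r n N : nat) :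
  (k * n = 2 * N)%N -> c * logb (k%:R - 1) n%:R <= r%:R ->
  (#|family 'I_n k r N| <= #|high_girth_graphs c k n|)%N.
Proof.
move=> kN cr.
apply: leq_trans (leq_imset_card (@edges 'I_n) _).
apply/subset_leq_card/subsetP => E EF.
have kT : (k * #|'I_n| = 2 * N)%N by rewrite card_ord.
have := sum_deficit kT EF; rewrite subnn muln0 => /eqP; rewrite sum_nat_eq0.
move=> /forallP sat; case/familyP: EF => sE dE lE _.
apply/imsetP; exists (SGraph sE) => //; rewrite inE; apply/andP; split.
  apply/forallP => x; rewrite eqn_leq; have := sat x; have := dE x.
  by rewrite /deg /= => -> /=; rewrite subn_eq0.
apply: le_ereal_inf_tmp => _ [s [cs s2] <-]; rewrite lee_fin.
apply: le_trans cr _; rewrite ler_nat; apply: leq_trans (ltnW (lE s cs s2)).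
by [].
Qed.

Lemma fact_le_expn m j : (j <= m)%N -> (j`! <= m ^ j)%N.
Proof.
elim: j => // j IH jm; rewrite factS expnS.
by apply: leq_mul => //; apply: IH; apply: ltnW.
Qed.

Section Asymptotics.
Variable R : realType.
Implicit Types c K : R.

(** The quotient of [N^N] by [N!] is a single term of the exponential series at [N]. *)
Lemma expn_le_expR_fact (N : nat) : N%:R ^+ N <= expR N%:R * N`!%:R :> R.
Proof.
case: N => [|N]; first by rewrite expr0 expR0 fact0 mulr1.
rewrite -ler_pdivrMr ?ltr0n ?fact_gt0 //.
apply: le_trans (expR_ge1Dxn N (ler0n R N.+1)).
by rewrite lerDr.
Qed.

(** For [d = 1 - c] and [L = ln n], the quadratic term [(d L)^2 / 2] of the exponential already
    dominates [K L] once [L >= 2 K / d^2]. *)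
Lemma linear_le_expR_ln c K : c < 1 -> exists N : nat, forall n : nat,
  (N <= n)%N -> 1 <= ln n%:R :> R /\ K * ln n%:R <= expR ((1 - c) * ln n%:R).
Proof.
move=> c1; have d0 : 0 < 1 - c by lra.
pose X := `|2 * K / (1 - c) ^+ 2| + 1.
exists (Num.truncn (expR X)).+1 => n Nn.
have Xn : expR X <= n%:R.
  by apply: ltW; apply: lt_le_trans (truncnS_gt _) _; rewrite ler_nat.
have XL : X <= ln n%:R by rewrite -ler_expR lnK // posrE (lt_le_trans (expR_gt0 X)).
have L1 : 1 <= ln n%:R :> R by apply: le_trans XL; rewrite lerDr.
split=> //; set L := ln n%:R in XL L1 *.
have dL0 : 0 <= (1 - c) * L by rewrite mulr_ge0; lra.
apply: le_trans (expR_ge1Dxn 1 dL0).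
have KL : 2 * K / (1 - c) ^+ 2 <= L.
  by apply: le_trans (ler_norm _) (le_trans _ XL); rewrite lerDl.
rewrite ler_pdivrMr ?exprn_gt0 // in KL.
have : 2 * K * L <= L * (1 - c) ^+ 2 * L by rewrite ler_wpM2r //; lra.
rewrite (_ : 2`!%:R = 2) // exprMn; move: ((1 - c) ^+ 2) => t.
rewrite expr2; lra.
Qed.

End Asymptotics.

(** * Choice of constants and assembly of the estimates *)

Theorem theorem1p2 (R : realType) (c : R) (k : nat)
    (c_gt0 : 0 < c) (c_lt1 : c < 1) (k_ge3 : (3 <= k)%N) :
  exists2 gamma : R, 0 < gamma &
    exists N : nat, forall n : nat, (N <= n)%N -> ~~ odd n ->
      (gamma * n%:R) ^+ (k * n)./2 <= #|high_girth_graphs c k n|%:R.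
Proof.
have e0 : 0 < expR 1 :> R by exact: expR_gt0.
have k_gt0 : (0 < k)%N by lia.
have k1_gt0 : (0 < k.-1)%N by lia.
have k0 : 0 < k%:R :> R by rewrite ltr0n.
(* The final estimate is [N^N <= (e k)^(2N) |A_N|], and [N / (e k)^2 = n / (2 e^2 k)] for
   [N = k n / 2]. *)
exists (2 * expR 1 ^+ 2 * k%:R)^-1.
  by rewrite invr_gt0 !mulr_gt0 ?exprn_gt0.
set a : R := k.-1%:R.
have a2 : 2 <= a by rewrite ler_nat; lia.
have ak : k%:R - 1 = a by rewrite -(natrB _ k_gt0) subn1.
have a0 : 0 < a by lra.
have la0 : 0 < ln a by apply: ln_gt0; lra.
(* The constant is tuned for [JN]: [J <= k^2 a n^c], so [8 J L <= (k / 2) n^c (16 k a L)], which is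
   at most [k n / 2]. *)
have [N0 hN0] := linear_le_expR_ln (16 * k%:R * a) c_lt1.
exists (maxn N0 k.*2) => n; rewrite geq_max => /andP[/hN0[L1 KL] kn] even_n.
set N := ((k * n)./2)%N.
have kN : (k * n = 2 * N)%N by rewrite /N mul2n even_halfK // oddM (negPf even_n) andbF.
have n0 : 0 < n%:R :> R by rewrite ltr0n (leq_trans _ kn) // double_gt0.
set L := ln n%:R in L1 KL.
have L0 : 0 <= L by exact: le_trans ler01 L1.
have nL : n%:R = expR L by rewrite lnK.
(* The successor makes [r] positive and at least the required girth, while exceeding it by at most
   1, which costs only a factor [a] in [a ^+ r]. *)
pose r := (Num.truncn (c * L / ln a)).+1.
have q0 : 0 <= c * L / ln a by rewrite !mulr_ge0 ?invr_ge0 // ltW.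
have rlow : c * L / ln a <= r%:R by exact/ltW/truncnS_gt.
have rup : r%:R <= c * L / ln a + 1.
  by rewrite -natr1 lerD2r truncn_le.
pose J := (k * (k * k.-1 ^ r))%N.
have J0 : (0 < J)%N by rewrite !muln_gt0 expn_gt0 k_gt0 k1_gt0.
have ar : a ^+ r <= expR (c * L) * a.
  have -> : a ^+ r = expR (r%:R * ln a) by rewrite expRM_natl lnK // posrE.
  have -> : expR (c * L) * a = expR (c * L + ln a) by rewrite expRD lnK // posrE.
  rewrite ler_expR; apply: le_trans (ler_wpM2r (ltW la0) rup) _.
  by rewrite mulrDl mul1r divfK // gt_eqF.
have JN : 8 * J%:R * L <= N%:R :> R.
  have NE : 2 * N%:R = k%:R * n%:R :> R by rewrite -!natrM kN.
  have JE : J%:R = k%:R * (k%:R * a ^+ r) :> R by rewrite !natrM natrX.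
  have -> : N%:R = k%:R * n%:R / 2 :> R by rewrite -NE; field.
  rewrite JE nL (_ : expR L = expR (c * L) * expR ((1 - c) * L)); last first.
    by rewrite -expRD; congr expR; ring.
  set A := expR (c * L) in ar *; have A0 : 0 < A by exact: expR_gt0.
  have w0 : 0 <= 8 * (k%:R * k%:R) * L.
    by rewrite !mulr_ge0 ?ler0n.
  have h1 := ler_wpM2l w0 ar.
  have h2 : k%:R * A * (16 * k%:R * a * L) <= k%:R * A * expR ((1 - c) * L).
    by rewrite ler_pM2l // mulr_gt0.
  move: h1 h2; set y := expR _; move: (a ^+ r) (k%:R : R) => z K; clear; lra.
have JN8 : (8 * J <= N)%N.
  rewrite -(ler_nat R) natrM; apply: le_trans JN; rewrite ler_peMr //.
apply: (@le_trans _ _ #|family 'I_n k r N|%:R); last first.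
  rewrite ler_nat; apply: card_family_le_high_girth => //.
  by rewrite /logb ak -/L mulrA.
have kT : (k * #|'I_n| = 2 * N)%N by rewrite card_ord.
have /= := fact_le_family (r := r) k_ge3 isT kT; rewrite -/J card_ord => /(_ _) hfact.
have {}hfact : (N`! <= J`! ^ 2 * k ^ (2 * N) * n ^ (4 * J) * #|family 'I_n k r N|)%N.
  by apply: hfact; apply: leq_trans JN8; rewrite ltn_pmul2r.
(* From [J <= N <= n^2] one gets [J! <= J^J <= n^(2J)]. All factors involving [J] thus total at most
   [n^(8J)], which [JN] bounds by [e^N]. *)
have Jfact : (J`! ^ 2 <= n ^ (4 * J))%N.
  have Jn : (J <= n ^ 2)%N.
    apply: leq_trans (leq_trans (leq_pmull J _) JN8) _ => //.
    rewrite -mulnn; apply: leq_trans (leq_pmull N (_ : 0 < 2)%N) _ => //.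
    by rewrite -kN leq_mul2r (leq_trans _ kn) ?orbT // -addnn leq_addr.
  rewrite (_ : 4 * J = 2 * J * 2)%N; last by rewrite mulnAC.
  by rewrite expnM leq_exp2r // expnM fact_le_expn.
set F := #|_| in hfact *.
have nJ : n%:R ^+ (8 * J) <= expR N%:R :> R.
  by rewrite nL -expRM_natl ler_expR natrM.
(* One factor [e^N] comes from [N!], the other from [n^(8J)]. *)
have main : N%:R ^+ N <= expR N%:R * (expR N%:R * k%:R ^+ (2 * N) * F%:R) :> R.
  apply: le_trans (expn_le_expR_fact R N) _; rewrite ler_pM2l ?expR_gt0 //.
  apply: (@le_trans _ _ (n%:R ^+ (8 * J) * k%:R ^+ (2 * N) * F%:R)); last first.
    by rewrite -!mulrA ler_wpM2r // mulr_ge0 ?exprn_ge0.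
  rewrite -!natrX -!natrM ler_nat; apply: leq_trans hfact _.
  rewrite leq_mul2r; apply/orP; right.
  rewrite mulnAC leq_mul2r; apply/orP; right.
  have -> : (8 * J = 4 * J + 4 * J)%N by rewrite -mulnDl.
  by rewrite expnD leq_mul2r Jfact orbT.
have NE : (2 * expR 1 ^+ 2 * k%:R)^-1 * n%:R = N%:R / (expR 1 ^+ 2 * k%:R ^+ 2) :> R.
  have NE : 2 * N%:R = k%:R * n%:R :> R by rewrite -!natrM kN.
  have -> : N%:R = k%:R * n%:R / 2 :> R by rewrite -NE; field.
  by field; rewrite !gt_eqF.
rewrite NE expr_div_n ler_pdivrMr ?exprn_gt0 ?mulr_gt0 ?exprn_gt0 //.
apply: le_trans main _.
have -> : expR N%:R = expR 1 ^+ N :> R by rewrite -expRM_natl mulr1.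
rewrite exprMn -!exprM (mul2n N) -addnn !exprD.
by rewrite le_eqVlt; apply/orP; left; apply/eqP; ring.
Qed.
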